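(* Let $G$ be a group and let $\mathrm{ZR}_*(G)$ denote either $\mathrm{ZR}_l(G)$ or $\mathrm{ZR}(G)$. Then $\mathrm{ZR}_*(G)$ is compact for the Patch topology. Therefore it is compact for the Zariski topology and for the Inverse topology.
   Context: A left-invariant preorder on a group $G$ is a binary relation $\preceq$ on $G$ that is total ($u\preceq v$ or $v\preceq u$ for all $u,v\in G$), transitive, and such that $u\preceq v$ implies $wu\preceq wv$ for all $u,v,w\in G$. It is bi-invariant if in addition $u\preceq v$ implies $uw\preceq vw$. $\mathrm{ZR}_l(G)$ is the set of left-invariant preorders on $G$ and $\mathrm{ZR}(G)$ the set of bi-invariant ones. Write $u\prec v$ if $u\preceq v$ and not $v\preceq u$. For $u\in G$ set $\mathcal O_u=\{\preceq\in\mathrm{ZR}_*(G)\mid u\succeq 1\}$ and $\mathcal U_u=\{\preceq\in\mathrm{ZR}_*(G)\mid u\succ 1\}$. The Zariski topology on $\mathrm{ZR}_*(G)$ is the topology generated by the sets $\mathcal O_u$ ($u\in G$), the Inverse topology is the one generated by the sets $\mathcal U_u$ ($u\in G$), and the Patch topology is the one generated by all the $\mathcal O_u$ and $\mathcal U_u$. Compact means that every open cover has a finite subcover (no separation axiom is required). *)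

(* Defs.v *)
From HB Require Import structures.
From mathcomp Require Import all_boot.
From mathcomp Require Import all_classical topology_structure compact.

Set Implicit Arguments.
Unset Strict Implicit.
Unset Printing Implicit Defensive.

Local Open Scope classical_set_scope.
Local Open Scope group_scope.

(* [X] endowed with the coarsest topology in which all members of [B] are
   open; the parameter [B] only selects the topology. *)
Definition generated_topology (X : choiceType) (B : set (set X)) : Type := X.

HB.instance Definition _ (X : choiceType) (B : set (set X)) :=
  Choice.on (generated_topology B).
HB.instance Definition _ (X : choiceType) (B : set (set X)) :=
  isSubBaseTopological.Build (generated_topology B) B id.

Section Preorders.
Variable G : groupType.

(* Relations are boolean-valued; since [boolp] makes every proposition
   decidable, [rel G] contains all binary relations on [G]. Reflexivity follows
   from totality. *)
Definition left_invariant_preorder (R : rel G) : Prop :=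
  [/\ total R, transitive R & forall u v w, R u v -> R (w * u) (w * v)].

Definition bi_invariant_preorder (R : rel G) : Prop :=
  left_invariant_preorder R /\ forall u v w, R u v -> R (u * w) (v * w).

Definition ZR_l : set (rel G) := [set R | left_invariant_preorder R].
Definition ZR : set (rel G) := [set R | bi_invariant_preorder R].

Definition strict_part (R : rel G) : rel G := fun u v => R u v && ~~ R v u.

(* [S] stands for either [ZR_l] or [ZR], and is used as a type (the subtype of
   [rel G] of its elements). *)
Variable S : set (rel G).

Definition OO (u : G) : set S := [set R : S | val R 1 u].
Definition UU (u : G) : set S := [set R : S | strict_part (val R) 1 u].

Definition zariski_topology : topologicalType := generated_topology (range OO).
Definition inverse_topology : topologicalType := generated_topology (range UU).
Definition patch_topology : topologicalType :=
  generated_topology (range OO `|` range UU).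

End Preorders.

Arguments ZR_l G : clear implicits.
Arguments ZR G : clear implicits.

(* Main.v *)
Require Import Defs.
From HB Require Import structures.
From mathcomp Require Import all_boot.
From mathcomp Require Import all_classical topology_structure compact.

(** A space is compact as soon as each of its ultrafilters converges, and
    convergence to a point may be tested on a subbase.  An ultrafilter on a set
    of preorders has a natural limit relation: [u] is below [v] in the limit
    when [u] is below [v] for almost all preorders, in the sense of the
    ultrafilter ([limit_rel]).  The axioms of (left- or bi-)invariant preorders
    survive the passage to the limit: transitivity and invariance derive one
    comparison from at most two others, and a filter is closed under finite
    intersections and supersets; totality is preserved because an ultrafilter containing a union of two sets contains
    one of them.

    It remains to see that the ultrafilter contains every subbasic set around
    its limit.  For the sets [OO u] this is the definition of the limit; for
    the sets [UU u] it holds because a comparison that fails in the limit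
    fails almost everywhere, again since the filter is an ultrafilter.  This
    covers the subbase of the Patch topology, hence those of the coarser
    Zariski and Inverse topologies. *)

Local Open Scope classical_set_scope.

(** Were there no finite subcover, the complements of the members of an open
    cover would lie in a common ultrafilter; the member of the cover containing
    its limit would then belong to the ultrafilter together with its
    complement. *)
Lemma ultra_cvg_cover_compact (T : topologicalType) :
  (forall F : set_system T, UltraFilter F -> exists p : T, F --> p) ->
  cover_compact [set: T].
Proof.
move=> Fcvg I D f fop fcov; apply: contrapT => nofin.
(* A finite subfamily of the complements with empty intersection would be a
   finite subcover. *)
have fip : finI D (fun i => ~` f i).
  move=> E ED; apply: contrapT => capE; apply: nofin; exists E => // x _.
  apply: contrapT => xE; apply: capE; exists x => i Ei fix_.
  by apply: xE; exists i.
have [F [FU sF]] := ultraFilterLemma (finI_filter fip).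
have [p Fp] := Fcvg F FU.
have [i Di fip_] := fcov p Logic.I.
have FP : ProperFilter F by exact: ultra_proper.
have Ffi : F (f i) by apply: Fp; apply: open_nbhs_nbhs; split => //; exact: fop.
have FCfi : F (~` f i).
  by apply: sF; exists (~` f i) => //; exact: (finI_from1 (fun j => ~` f j)).
have /filter_ex [x []] : F (f i `&` ~` f i) by exact: filterI.
by [].
Qed.

(** A basic open set is a finite intersection of members of the subbase, and
    filters are closed under those. *)
Lemma cvg_generated_topology (X : choiceType) (B : set (set X))
    (F : set_system X) (p : X) :
    Filter F -> (forall A, B A -> A p -> F A) ->
  F --> (p : generated_topology B).
Proof.
move=> FF FB A; rewrite nbhsE => -[V [[K Kfin <-] [C KC Cp]] VA].
have [E EB EC] := Kfin _ KC.
suff FC : F C by apply: filterS FC => x Cx; apply: VA; exists C.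
rewrite -EC; apply: filter_bigI => i Ei; apply: FB; first exact/set_mem/EB.
by move: Cp; rewrite -EC; apply.
Qed.

Section LimitRel.
Variables (G : groupType) (T : Type) (r : T -> rel G) (F : set_system T).

Definition limit_rel : rel G := fun u v => `[< F [set t | r t u v] >].

Lemma limit_relP u v : reflect (F [set t | r t u v]) (limit_rel u v).
Proof. exact: asboolP. Qed.

(** This is where an arbitrary filter would not do: it may contain neither a
    set nor its complement. *)
Lemma limit_relPn u v : UltraFilter F -> ~~ limit_rel u v ->
  F [set t | ~~ r t u v].
Proof.
move=> FU /limit_relP nF.
have [//|] := in_ultra_setVsetC [set t | r t u v] FU.
by have FP := ultra_proper; apply: filterS => t /negP.
Qed.

Lemma limit_rel_strict u v : UltraFilter F ->
  strict_part limit_rel u v -> F [set t | strict_part (r t) u v].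
Proof.
move=> FU /andP[/limit_relP Fuv /(limit_relPn _ _ FU) Fvu].
have FP : ProperFilter F by exact: ultra_proper.
by apply: filterS2 Fuv Fvu => t /= ruv rvu; apply/andP.
Qed.

End LimitRel.

Arguments limit_rel {G T} r F.
Arguments limit_relP {G T r F u v}.
Arguments limit_relPn {G T r F u v} FU.

Lemma limit_left_invariant_preorder (G : groupType) (T : Type) (r : T -> rel G)
    (F : set_system T) :
    UltraFilter F -> (forall t, left_invariant_preorder (r t)) ->
  left_invariant_preorder (limit_rel r F).
Proof.
move=> FU rP; have FP : ProperFilter F by exact: ultra_proper.
split.
(* If [u] is not below [v] in the limit, it fails to be almost everywhere,
   where [v] is below [u] by totality. *)
- move=> u v; case: (boolP (limit_rel _ _ u v)) => //=.
  move=> /(limit_relPn FU) Fuv; apply/limit_relP.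
  apply: filterS Fuv => t /= /negPf ruv.
  by have [/(_ u v)] := rP t; rewrite ruv.
- move=> v u w /limit_relP Fuv /limit_relP Fvw; apply/limit_relP.
  apply: filterS2 Fuv Fvw => t /=.
  by have [_ tr _] := rP t; exact: tr.
- move=> u v w /limit_relP Fuv; apply/limit_relP; apply: filterS Fuv => t /=.
  by have [_ _ inv] := rP t; exact: inv.
Qed.

Lemma limit_bi_invariant_preorder (G : groupType) (T : Type) (r : T -> rel G)
    (F : set_system T) :
    UltraFilter F -> (forall t, bi_invariant_preorder (r t)) ->
  bi_invariant_preorder (limit_rel r F).
Proof.
move=> FU rP; have FP : ProperFilter F by exact: ultra_proper.
split; first by apply: limit_left_invariant_preorder => t; have [] := rP t.
move=> u v w /limit_relP Fuv; apply/limit_relP; apply: filterS Fuv => t /=.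
by have [_ inv] := rP t; exact: inv.
Qed.

(** An ultrafilter converges to its limit relation in every topology generated
    by sets [OO u] and [UU u], so one argument serves the Patch, Zariski and
    Inverse topologies.  The first hypothesis puts that limit back in [S]. *)
Lemma cover_compact_sub_patch (G : groupType) (S : set (rel G))
    (B : set (set S)) :
    (forall F : set_system S, UltraFilter F -> S (limit_rel val F)) ->
    B `<=` range (OO (S := S)) `|` range (UU (S := S)) ->
  cover_compact [set: generated_topology B].
Proof.
move=> Slim Bsub; apply: ultra_cvg_cover_compact => F FU.
have FP : ProperFilter F by exact: ultra_proper.
exists (SigSub (mem_set (Slim F FU)) : S).
apply: cvg_generated_topology => A /Bsub [] [u _ <-].
- by move=> /limit_relP.
- exact: limit_rel_strict.
Qed.

Theorem theorem2p30 (G : groupType) (S : set (rel G))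
    (HS : S = ZR_l G \/ S = ZR G) :
  cover_compact [set: patch_topology S] /\
  (cover_compact [set: zariski_topology S] /\
   cover_compact [set: inverse_topology S]).
Proof.
have Slim (F : set_system S) : UltraFilter F -> S (limit_rel val F).
  move=> FU; case: HS => SE; rewrite {1}SE.
  - apply: limit_left_invariant_preorder => R.
    by have := set_valP R; rewrite {1}SE.
  - apply: limit_bi_invariant_preorder => R.
    by have := set_valP R; rewrite {1}SE.
split; [|split]; apply: cover_compact_sub_patch => //.
Qed.
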